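(* Let $G$ be a compact group with identity $e$ and Haar probability measure $\nu$, let $A \subset G$ with $A = A^{-1}$ and $e \in A$, and let $W \leq G$ be a closed subgroup with $wA = Aw = A$ for all $w \in W$. Consider the dual problem: the supremum of $c \in \mathbb{R}$ over pairs $(c,\mu)$ where $\mu$ is a nonnegative Radon measure on $G$ supported in $\overline{A^c}$ with $\delta_e + \mu - c\nu \in \mathcal{M}_{\succeq 0}(G)$. The value of this supremum is unchanged if one additionally requires $L_w^*\mu = R_w^*\mu = \mu$ for all $w \in W$.
   Context: $\mathcal{M}_{\succeq 0}(G)$ is the set of Radon measures $\lambda$ on $G$ with $\int_G f\,d\lambda \geq 0$ for all continuous positive definite $f$ (i.e., $\sum_{i,j}\overline{c_i}f(g_i^{-1}g_j)c_j\geq 0$ for all finite choices); equivalently, $\int_G \pi(g)\,d\lambda(g) \succeq 0$ for every irreducible unitary representation $\pi$. $\delta_e$ is the Dirac mass at $e$. For $w \in G$, $L_w^*\mu$ and $R_w^*\mu$ are the measures defined by $\int f\, dL_w^*\mu = \int f(w^{-1}g)\,d\mu(g)$ and $\int f\, dR_w^*\mu = \int f(gw)\,d\mu(g)$ for $f \in C(G)$. *)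

(* Defs.v *)
From mathcomp Require Import all_boot all_algebra.
From mathcomp Require Import all_classical all_reals all_analysis.
From mathcomp Require Import complex.
Import GRing.Theory Num.Theory ComplexField.

Set Implicit Arguments.
Unset Strict Implicit.
Unset Printing Implicit Defensive.

Local Open Scope classical_set_scope.
Local Open Scope ring_scope.

Record is_compact_group (G : ptopologicalType) (mul : G -> G -> G)
    (inv : G -> G) (e : G) : Prop := {
  cg_assoc : forall x y z, mul x (mul y z) = mul (mul x y) z;
  cg_mul1g : forall x, mul e x = x;
  cg_mulVg : forall x, mul (inv x) x = e;
  cg_mul_cont : continuous (fun p : G * G => mul p.1 p.2);
  cg_inv_cont : continuous inv;
  cg_hausdorff : hausdorff_space G;
  cg_compact : compact [set: G] }.

Definition borel (G : ptopologicalType) : measurableType (sigma_display (@open G)) :=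
  g_sigma_algebraType (@open G).

Section Defs.
Context {R : realType} {G : ptopologicalType}.

Notation measureG := ({measure set (borel G) -> \bar R}).

Definition radon (mu : measureG) : Prop :=
  [/\ (mu [set: G] < +oo)%E,
      (forall B : set (borel G), measurable B ->
         mu B = ereal_inf [set mu U | U in [set U : set G | open U /\ B `<=` U]]) &
      (forall U : set G, open U ->
         mu U = ereal_sup [set mu K | K in [set K : set G | compact K /\ K `<=` U]])].

Definition msupp (mu : measureG) : set G :=
  [set x | forall U : set G, open U -> U x -> (0 < mu U)%E].

Definition Rint (mu : measureG) (f : G -> R) : R := Rintegral mu [set: borel G] f.

Definition cint (mu : measureG) (f : G -> R[i]) : R[i] :=
  (Rint mu (fun x => complex.Re (f x)) +i* Rint mu (fun x => complex.Im (f x)))%C.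

Definition ccontinuous (f : G -> R[i]) : Prop :=
  continuous (fun x : G => (complex.Re (f x) : R^o)) /\ continuous (fun x : G => (complex.Im (f x) : R^o)).

Definition pos_def (mul : G -> G -> G) (inv : G -> G) (f : G -> R[i]) : Prop :=
  ccontinuous f /\
  forall (n : nat) (g : 'I_n -> G) (c : 'I_n -> R[i]),
    0 <= \sum_(i < n) \sum_(j < n) (c i)^*%C * f (mul (inv (g i)) (g j)) * c j.

(* delta_e + mu - c nu is in M_{>=0}(G): its integral against every continuous
   positive definite function is >= 0 (in R[i], i.e. real and nonnegative). *)
Definition dual_psd (mul : G -> G -> G) (inv : G -> G) (e : G)
    (nu mu : measureG) (c : R) : Prop :=
  forall f : G -> R[i], pos_def mul inv f ->
    0 <= f e + cint mu f - (c%:C)%C * cint nu f.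

Definition haar_prob (mul : G -> G -> G) (nu : measureG) : Prop :=
  [/\ radon nu, nu [set: G] = 1%E &
      forall (g : G) (B : set (borel G)), measurable B -> nu (mul g @` B) = nu B].

Definition dual_feasible (mul : G -> G -> G) (inv : G -> G) (e : G)
    (A : set G) (nu mu : measureG) (c : R) : Prop :=
  [/\ radon mu, msupp mu `<=` closure (~` A) & dual_psd mul inv e nu mu c].

(* L_w^* mu = mu and R_w^* mu = mu for all w in W, where
   int f dL_w^*mu = int f(w^-1 g) dmu(g),  int f dR_w^*mu = int f(g w) dmu(g),
   for all f in C(G). *)
Definition W_invariant (mul : G -> G -> G) (inv : G -> G) (W : set G)
    (mu : measureG) : Prop :=
  forall w, W w -> forall f : G -> R[i], ccontinuous f ->
    cint mu (fun g => f (mul (inv w) g)) = cint mu f /\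
    cint mu (fun g => f (mul g w)) = cint mu f.

End Defs.

(* Main.v *)
(** Averaging a feasible measure [mu] over two-sided translations by [W] preserves
    feasibility. For a probability vector [p] on [W] and [f] positive definite,
    [f_p g = sum_(a, b) p_a p_b f (a g b^-1)] is again positive definite,
    [f_p e <= f e] and [nu f_p = nu f], so [f |-> mu f_p] is feasible with the
    same [c].

    Neither the Haar measure of [W] nor the Riesz representation theorem is
    needed. Almost invariant vectors [p] exist because, for a small neighbourhood
    [V] of [e], the [W]-invariant open set [W V] can be cut into finitely many
    small pieces near points of [W], weighted by [nu]. Along an ultrafilter of
    such [p], the set functions [B |-> sum_(a, b) p_a p_b mu (a^-1 B b)] converge to a
    finitely additive [m], and [K |-> m K] on compact sets induces a Radon
    measure [mu'] with [mu' V <= m V] for open [V] and the same total mass. A layer cake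
    estimate then gives [int f d mu' <= lim mu f_p] for continuous [f >= 0], and
    equality follows by applying this to [M - f]. *)
Require Import Defs.
From HB Require Import structures.
From mathcomp Require Import all_boot all_order all_algebra.
From mathcomp Require Import all_classical all_reals all_analysis.
From mathcomp Require Import complex measurable_realfun ring.
Import Order.TTheory GRing.Theory Num.Theory ComplexField.
Import numFieldNormedType.Exports.
Set Implicit Arguments.
Unset Strict Implicit.
Unset Printing Implicit Defensive.
Local Open Scope classical_set_scope.
Local Open Scope ring_scope.

(** * Radon measures from finitely additive set functions *)

Lemma measurable_borel_open (T : ptopologicalType) (U : set T) :
  open U -> measurable (U : set (borel T)).
Proof. by move=> oU; exact: sub_sigma_algebra. Qed.

Lemma measurable_borel_closed (T : ptopologicalType) (C : set T) :
  closed C -> measurable (C : set (borel T)).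
Proof.
move=> cC; rewrite -[C]setCK; apply: measurableC.
by apply: measurable_borel_open; exact: closed_openC.
Qed.

Section content.
Context {R : realType} {T : ptopologicalType}.
Hypotheses (hausT : hausdorff_space T) (compT : compact [set: T]).
Variable m : set T -> R.
Hypothesis m_ge0 : forall A : set (borel T), measurable A -> 0 <= m A.
Hypothesis m_additive : forall A B : set (borel T), measurable A ->
  measurable B -> A `&` B = set0 -> m (A `|` B) = m A + m B.

Let measurable_compact (K : set T) : compact K -> measurable (K : set (borel T)).
Proof. by move=> cK; apply: measurable_borel_closed; exact: compact_closed. Qed.

Let compact_of_closed (K : set T) : closed K -> compact K.
Proof. by move=> cK; exact: (subclosed_compact cK compT). Qed.

Let m_set0 : m set0 = 0.
Proof.
have := @m_additive set0 set0 measurable0 measurable0 (setI0 _).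
by rewrite setU0 => /eqP; rewrite -subr_eq subrr eq_sym => /eqP.
Qed.

Let m_mono (A B : set (borel T)) : measurable A -> measurable B ->
  A `<=` B -> m A <= m B.
Proof.
move=> mA mB AB; rewrite -(setDUK AB) m_additive//.
- by rewrite lerDl; apply: m_ge0; exact: measurableD.
- exact: measurableD.
- by rewrite setDIK.
Qed.

Let m_subadditive (A B : set (borel T)) : measurable A -> measurable B ->
  m (A `|` B) <= m A + m B.
Proof.
move=> mA mB.
have -> : A `|` B = A `|` (B `\` A).
  by apply/seteqP; split=> x /=; have := pselect (A x); tauto.
rewrite m_additive//; last by rewrite setDIK.
- by rewrite lerD2l m_mono//; exact: measurableD.
- exact: measurableD.
Qed.

(** [m] is only finitely additive. Passing to suprema over compact sets restores countable
    subadditivity on open sets, because compactness turns countable covers into finite ones. *)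
Definition inner_content (U : set T) : \bar R :=
  ereal_sup [set (m K)%:E | K in [set K | compact K /\ K `<=` U]].

Definition outer_content (E : set T) : \bar R :=
  ereal_inf [set inner_content U | U in [set U | open U /\ E `<=` U]].

Local Open Scope ereal_scope.

Lemma inner_content_ge (K U : set T) : compact K -> K `<=` U ->
  (m K)%:E <= inner_content U.
Proof. by move=> cK KU; apply: ereal_sup_ubound; exists K. Qed.

Lemma inner_content_ge0 (U : set T) : 0 <= inner_content U.
Proof.
have : (m set0)%:E <= inner_content U.
  by apply: inner_content_ge => //; exact: compact0.
by rewrite m_set0.
Qed.

Lemma inner_content_set0 : inner_content set0 = 0.
Proof.
apply/eqP; rewrite eq_le inner_content_ge0 andbT.
apply: ge_ereal_sup => _ [K [_ K0] <-]; have -> : K = set0 by apply/seteqP; split.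
by rewrite m_set0.
Qed.

Lemma le_inner_content (U V : set T) : U `<=` V ->
  inner_content U <= inner_content V.
Proof.
move=> UV; apply: ge_ereal_sup => _ [K [cK KU] <-].
by apply: inner_content_ge => //; exact: subset_trans UV.
Qed.

Lemma inner_content_le (U : set T) : open U -> inner_content U <= (m U)%:E.
Proof.
move=> oU; apply: ge_ereal_sup => _ [K [cK KU] <-].
rewrite lee_fin m_mono//; first exact: measurable_compact.
exact: measurable_borel_open.
Qed.

Lemma inner_content_fin (U : set T) : inner_content U \is a fin_num.
Proof.
rewrite ge0_fin_numE ?inner_content_ge0//.
apply: le_lt_trans (le_inner_content (@subsetT _ U)) _.
by apply: le_lt_trans (inner_content_le openT) _; rewrite ltry.
Qed.

(** A compact [K] inside the union splits into two compact sets, one in each open set. Normality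
    puts a neighbourhood [N] of the closed set [K] minus [V] with closure inside [U]; with [Q] open
    between them, the pieces are [K] in the closure of [N] and [K] outside [Q]. *)
Lemma inner_content_setU (U V : set T) : open U -> open V ->
  inner_content (U `|` V) <= inner_content U + inner_content V.
Proof.
move=> oU oV; apply: ge_ereal_sup => _ [K [cK KUV] <-].
have clK := compact_closed hausT cK.
have clKV : closed (K `&` ~` V) by apply: closedI => //; exact: open_closedC.
have nU : set_nbhs (K `&` ~` V) U.
  apply/set_nbhsP; exists U; split => // x [Kx nVx].
  by case: (KUV _ Kx).
have [N /set_nbhsP[Q [oQ KVQ QN]] NU] := compact_normal hausT compT clKV nU.
have c1 : compact (K `&` closure N).
  by apply: compact_of_closed; apply: closedI => //; exact: closed_closure.
have c2 : compact (K `&` ~` Q).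
  by apply: compact_of_closed; apply: closedI => //; exact: open_closedC.
have KE : K = (K `&` closure N) `|` (K `&` ~` Q).
  apply/seteqP; split=> [x Kx|x]; last by move=> [[]|[]].
  have [Qx|nQx] := pselect (Q x); last by right.
  by left; split => //; apply: subset_closure; exact: QN.
apply: (@le_trans _ _ ((m (K `&` closure N))%:E + (m (K `&` ~` Q))%:E)).
  rewrite -EFinD lee_fin {1}KE m_subadditive//; exact: measurable_compact.
apply: leeD; apply: inner_content_ge => //.
  by move=> x [_]; exact: NU.
move=> x [Kx nQx]; apply: contrapT => nVx; apply: nQx; exact: KVQ.
Qed.

Lemma inner_content_bigcup (U : (set T)^nat) : (forall n, open (U n)) ->
  inner_content (\bigcup_n U n) <= \sum_(n <oo) inner_content (U n).
Proof.
move=> oU; apply: ge_ereal_sup => _ [K [cK KU] <-].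
(* Finitely many [U i] cover [K]; [N] exceeds all their indices. *)
have /= := cK; rewrite compact_cover => /(_ _ setT U) [//|//|D _ KD].
pose N := (\max_(i <- finmap.enum_fset D) i).+1%N.
have KN : K `<=` \big[setU/set0]_(i < N) U i.
  move=> x /KD[i /= iD Uix]; rewrite -bigcup_mkord; exists i => //=.
  by by rewrite /= ltnS /N; apply: (@leq_bigmax_seq _ _ _ id).
have fU n : open (\big[setU/set0]_(i < n) U i) /\
    inner_content (\big[setU/set0]_(i < n) U i) <= \sum_(i < n) inner_content (U i).
  elim: n => [|n [on IH]]; first by rewrite !big_ord0 inner_content_set0; split => //; exact: open0.
  rewrite !big_ord_recr/=; split; first exact: openU.
  by apply: le_trans (inner_content_setU _ _) _ => //; exact: leeD2r.
apply: le_trans (inner_content_ge cK KN) _.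
apply: le_trans (fU N).2 _.
rewrite (nneseries_split 0 N); last by move=> *; exact: inner_content_ge0.
rewrite add0n big_mkord leeDl// nneseries_ge0// => *; exact: inner_content_ge0.
Qed.

Lemma outer_content_open (U : set T) : open U ->
  outer_content U = inner_content U.
Proof.
move=> oU; apply/eqP; rewrite eq_le; apply/andP; split.
  by apply: ereal_inf_lbound; exists U => //; split.
by apply: le_ereal_inf_tmp => _ [V [oV UV] <-]; exact: le_inner_content.
Qed.

Lemma outer_content_ge0 (E : set T) : 0 <= outer_content E.
Proof. by apply: le_ereal_inf_tmp => _ [V _ <-]; exact: inner_content_ge0. Qed.

Lemma le_outer_content : {homo outer_content : A B / A `<=` B >-> A <= B}.
Proof.
move=> A B AB; apply: le_ereal_inf_tmp => _ [V [oV BV] <-].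
by apply: ereal_inf_lbound; exists V => //; split => //; exact: subset_trans BV.
Qed.

Lemma outer_content_set0 : outer_content set0 = 0.
Proof. by rewrite outer_content_open ?inner_content_set0//; exact: open0. Qed.

Lemma outer_content_fin (E : set T) : outer_content E \is a fin_num.
Proof.
rewrite ge0_fin_numE ?outer_content_ge0//.
apply: le_lt_trans (le_outer_content (@subsetT _ E)) _.
by rewrite outer_content_open ?ltey_eq ?inner_content_fin//; exact: openT.
Qed.

Lemma outer_content_adherent (E : set T) (eps : R) : (0 < eps)%R ->
  exists U, [/\ open U, E `<=` U & inner_content U <= outer_content E + eps%:E].
Proof.
move=> e0; have [_ [U [oU EU] <-] /ltW UE] :=
  lb_ereal_inf_adherent e0 (outer_content_fin E).
by exists U.
Qed.

Lemma inner_content_adherent (U : set T) (eps : R) : (0 < eps)%R ->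
  exists K, [/\ compact K, K `<=` U & inner_content U <= (m K)%:E + eps%:E].
Proof.
move=> e0; have [_ [K [cK KU] <-] UK] :=
  ub_ereal_sup_adherent e0 (inner_content_fin U).
by exists K; split => //; rewrite -leeBlDr// ltW.
Qed.

Lemma outer_content_sigma_subadditive : sigma_subadditive outer_content.
Proof.
move=> F; apply/lee_addgt0Pr => eps e0.
apply: le_trans (epsilon_trick _ _ (ltW e0)); last first.
  by move=> n; exact: outer_content_ge0.
have en n : (0 < eps / (2 ^ n.+1)%:R)%R by rewrite divr_gt0// ltr0n expn_gt0.
have /choice[U hU] n := outer_content_adherent (F n) (en n).
apply: (@le_trans _ _ (outer_content (\bigcup_n U n))).
  by apply: le_outer_content; apply: subset_bigcup => n _; case: (hU n).
have oU n : open (U n) by case: (hU n).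
rewrite outer_content_open; last exact: bigcup_open.
apply: le_trans (inner_content_bigcup oU) _.
apply: lee_nneseries => n _; first by move=> _; exact: inner_content_ge0.
by case: (hU n).
Qed.

HB.instance Definition _ := isOuterMeasure.Build R T outer_content
  outer_content_set0 outer_content_ge0 le_outer_content
  outer_content_sigma_subadditive.

(** For [V] open around [X], take [K] compact in [V] and [U], then [L] compact in [V] minus [K],
    each nearly optimal. Removing [K] rather than [U] keeps the second set open, and it still
    contains [X] minus [U]. As [K] and [L] are disjoint, additivity of [m] bounds their total by the
    content of [V]. Each of the three choices costs [eps / 3]. *)
Lemma caratheodory_outer_content_open (U : set T) : open U ->
  outer_content.-caratheodory U.
Proof.
move=> oU; apply: le_caratheodory_measurable => X.
apply/lee_addgt0Pr => eps e0.
have e3 : (0 < eps / 3)%R by rewrite divr_gt0.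
have [V [oV XV VX]] := outer_content_adherent X e3.
have [K [cK KVU mK]] := inner_content_adherent (V `&` U) e3.
have clK := compact_closed hausT cK.
have oVK : open (V `\` K) by apply: openI => //; exact: closed_openC.
have [L [cL LVK mL]] := inner_content_adherent (V `\` K) e3.
have XU : outer_content (X `&` U) <= (m K)%:E + (eps / 3)%:E.
  apply: le_trans mK; rewrite -outer_content_open; last exact: openI.
  by apply: le_outer_content; exact: setSI.
have XC : outer_content (X `&` ~` U) <= (m L)%:E + (eps / 3)%:E.
  apply: le_trans mL; rewrite -outer_content_open//.
  by apply: le_outer_content => x [/XV Vx nUx]; split => // /KVU[].
have KL : (m K)%:E + (m L)%:E <= inner_content V.
  rewrite -EFinD -m_additive.
  - apply: inner_content_ge; first exact: compactU.
    by move=> x [/KVU[]|/LVK[]].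
  - exact: measurable_compact.
  - exact: measurable_compact.
  - by apply/seteqP; split => // x [Kx /LVK[]].
apply: le_trans (leeD XU XC) _.
rewrite addeACA; apply: le_trans (leeD2r _ (le_trans KL VX)) _.
rewrite -addeA -!EFinD.
by rewrite leeD2l// lee_fin -!mulrDl -{1 2 3}(mulr1 eps) -!mulrDr -mulrA divff// mulr1.
Qed.

Lemma caratheodory_outer_content_borel (B : set (borel T)) : measurable B ->
  outer_content.-cara.-measurable B.
Proof.
apply: smallest_sub; last by move=> U; exact: caratheodory_outer_content_open.
by apply: sigma_algebra_measurable.
Qed.

(** A copy of [outer_content] typed on [borel T], so that the measure structure is attached to the
    Borel sets. *)
Definition content_measure (B : set (borel T)) : \bar R := outer_content B.

Let content_measure0 : content_measure set0 = 0.
Proof. exact: outer_content_set0. Qed.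

Let content_measure_ge0 B : 0 <= content_measure B.
Proof. exact: outer_content_ge0. Qed.

Let content_measure_sigma_additive : semi_sigma_additive content_measure.
Proof.
move=> F mF tF mUF; apply: (caratheodory_measure_sigma_additive _ tF).
- by move=> n; apply: caratheodory_outer_content_borel.
- exact: caratheodory_outer_content_borel.
Qed.

HB.instance Definition _ := isMeasure.Build _ _ _ content_measure
  content_measure0 content_measure_ge0 content_measure_sigma_additive.

Lemma radon_content_measure : radon content_measure.
Proof.
split.
- by rewrite ltey_eq outer_content_fin.
- move=> B _; rewrite /content_measure {1}/outer_content; congr ereal_inf.
  by apply/seteqP; split => _ [U [oU BU] <-]; exists U => //;
    rewrite /= /content_measure outer_content_open.
- move=> U oU; apply/eqP; rewrite eq_le; apply/andP; split.
    apply: (@le_trans _ _ (inner_content U)).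
      by apply: ereal_inf_lbound; exists U => //; split.
    apply: ge_ereal_sup => _ [K [cK KU] <-].
    apply: (@le_trans _ _ (content_measure K)); last by apply: ereal_sup_ubound; exists K.
    (* Every open [V] containing [K] has content at least [m K], so the measure dominates [m] on
       compact sets. *)
    by apply: le_ereal_inf_tmp => _ [V [oV KV] <-]; exact: inner_content_ge.
  by apply: ge_ereal_sup => _ [K [cK KU] <-]; exact: le_outer_content.
Qed.

Lemma content_measure_open (U : set T) : open U ->
  content_measure U <= (m U)%:E.
Proof.
by move=> oU; rewrite /content_measure outer_content_open// inner_content_le.
Qed.

(** The space is compact, so it competes in its own inner supremum and no mass is lost. *)
Lemma content_measure_setT : content_measure setT = (m setT)%:E.
Proof.
apply/eqP; rewrite eq_le content_measure_open/=; last exact: openT.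
rewrite /content_measure outer_content_open; last exact: openT.
exact: inner_content_ge.
Qed.

Lemma radon_of_content : exists mu : {measure set (borel T) -> \bar R},
  [/\ radon mu, forall U : set T, open U -> mu U <= (m U)%:E
    & mu [set: T] = (m [set: T])%:E].
Proof.
exists content_measure; split.
- exact: radon_content_measure.
- exact: content_measure_open.
- exact: content_measure_setT.
Qed.

End content.

(** * Almost invariant probability vectors on a compact group *)

Lemma continuous_measurable_borel (S T : ptopologicalType) (f : S -> T) :
  continuous f -> measurable_fun [set: borel S] (f : borel S -> borel T).
Proof.
move=> /continuousP cf; apply: (@measurability _ _ (borel S) (borel T) setT f open) => //.
by move=> _ [U oU <-]; rewrite setTI; apply: measurable_borel_open; exact: cf.
Qed.

Lemma measure_compact_eq0 (R : realType) (T : ptopologicalType)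
    (mu : {measure set (borel T) -> \bar R}) (K : set T) :
  compact K -> measurable (K : set (borel T)) ->
  (forall x, K x -> exists U : set T, [/\ open U, U x & mu U = 0%E]) ->
  mu K = 0%E.
Proof.
move=> cK mK K0.
have /choice[U U0] x : exists U : set T, K x -> [/\ open U, U x & mu U = 0%E].
  by have [/K0[U ?]|nKx] := pselect (K x); [exists U|exists set0].
have := cK; rewrite compact_cover => /(_ _ K U) [x /U0[]//|x Kx|D DK KD].
  by exists x => //; have [] := U0 _ Kx.
pose s : seq T := finmap.enum_fset D.
have [mD D0] : measurable (\bigcup_(x in [set` s]) U x : set (borel T)) /\
    mu (\bigcup_(x in [set` s]) U x) = 0%E.
  rewrite bigcup_seq big_seq_cond.
  apply: (big_ind (fun B : set (borel T) => measurable B /\ mu B = 0%E)).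
  - by rewrite measure0.
  - by move=> A B [mA A0] [mB B0]; split; [exact: measurableU|rewrite measureU0].
  - move=> x; rewrite andbT => /DK; rewrite inE => /U0[oU _ ->].
    by split => //; exact: measurable_borel_open.
by apply/eqP; rewrite eq_le measure_ge0 andbT -D0 le_measure ?inE.
Qed.

(** * Compact groups: cancellation rules, translations, uniform continuity *)

Section compact_group.
Context {G : ptopologicalType} (mul : G -> G -> G) (inv : G -> G) (e : G).
Hypothesis hG : is_compact_group mul inv e.

Let continuous_fst (A B : topologicalType) : continuous (@fst A B).
Proof. by move=> ?; exact: cvg_fst. Qed.

Let continuous_snd (A B : topologicalType) : continuous (@snd A B).
Proof. by move=> ?; exact: cvg_snd. Qed.

Let mulA := cg_assoc hG.
Let mul1 := cg_mul1g hG.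
Let mulV := cg_mulVg hG.

(** Only left identity and left inverses are axioms; the trick is to multiply on the left by [e]
    written as [inv (inv x)] times [inv x]. *)
Lemma cg_mulgV x : mul x (inv x) = e.
Proof.
rewrite -[mul x (inv x)]mul1 -{1}(mulV (inv x)) -mulA (mulA (inv x) x).
by rewrite mulV mul1 mulV.
Qed.

Lemma cg_mulg1 x : mul x e = x.
Proof. by rewrite -(mulV x) mulA cg_mulgV mul1. Qed.

Lemma cg_mulKg x y : mul (inv x) (mul x y) = y.
Proof. by rewrite mulA mulV mul1. Qed.

Lemma cg_mulVKg x y : mul x (mul (inv x) y) = y.
Proof. by rewrite mulA cg_mulgV mul1. Qed.

Lemma cg_mulgK x y : mul (mul x y) (inv y) = x.
Proof. by rewrite -mulA cg_mulgV cg_mulg1. Qed.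

Lemma cg_mulgVK x y : mul (mul x (inv y)) y = x.
Proof. by rewrite -mulA mulV cg_mulg1. Qed.

Lemma cg_invgK x : inv (inv x) = x.
Proof. by rewrite -[LHS]cg_mulg1 -(mulV x) cg_mulKg. Qed.

Lemma cg_invMg x y : inv (mul x y) = mul (inv y) (inv x).
Proof.
by rewrite -[RHS](cg_mulKg (mul x y)) -(mulA x) (mulA y) cg_mulgV mul1 cg_mulgV cg_mulg1.
Qed.

Lemma cg_continuous_mul (T : topologicalType) (f g : T -> G) :
  continuous f -> continuous g -> continuous (fun x => mul (f x) (g x)).
Proof.
move=> cf cg x.
apply: (@continuous_comp _ _ _ (fun x => (f x, g x)) (fun p => mul p.1 p.2)).
  by apply: cvg_pair; [exact: cf|exact: cg].
have := cg_mul_cont hG; exact.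
Qed.

Lemma cg_continuous_inv (T : topologicalType) (f : T -> G) :
  continuous f -> continuous (fun x => inv (f x)).
Proof. by move=> cf x; apply: continuous_comp; [exact: cf|have := cg_inv_cont hG; exact]. Qed.

Lemma cg_continuous_mull g : continuous (mul g).
Proof. by apply: cg_continuous_mul; [exact: cst_continuous|move=> x; exact: cvg_id]. Qed.

Lemma cg_continuous_mulr g : continuous (mul^~ g).
Proof. by apply: cg_continuous_mul; [move=> x; exact: cvg_id|exact: cst_continuous]. Qed.

Lemma cg_image_mull g (B : set G) : mul g @` B = mul (inv g) @^-1` B.
Proof.
apply/seteqP; split=> [_ [x Bx <-]|x Bx] /=; first by rewrite cg_mulKg.
by exists (mul (inv g) x) => //; rewrite cg_mulVKg.
Qed.

Lemma cg_open_image_mull g (B : set G) : open B -> open (mul g @` B).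
Proof.
move=> oB; rewrite cg_image_mull.
by move/continuousP : (@cg_continuous_mull (inv g)); apply.
Qed.

Lemma cg_nbhs_mul (N : set G) : nbhs e N ->
  exists M, [/\ open M, M e & forall a b, M a -> M b -> N (mul a b) /\ N (mul a (inv b))].
Proof.
move=> Ne.
have c1 : continuous (fun p : G * G => mul p.1 (inv p.2)).
  apply: cg_continuous_mul; first exact: continuous_fst.
  by apply: cg_continuous_inv; exact: continuous_snd.
have Ne1 : nbhs (mul e e) N by rewrite mul1.
have Ne2 : nbhs (mul e (inv e)) N by rewrite cg_mulgV.
have [[A1 A2] [/= nA1 nA2] A12] := cg_mul_cont hG (x := (e, e)) Ne1.
have [[B1 B2] [/= nB1 nB2] B12] := c1 (e, e) _ Ne2.
have : nbhs e ((A1 `&` A2) `&` (B1 `&` B2)) by do !apply: filterI.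
rewrite nbhsE => -[M [oM Me] sM]; exists M; split => // a b /sM[[? ?] [? ?]] /sM[[? ?] [? ?]].
by split; [exact: (A12 (a, b))|exact: (B12 (a, b))].
Qed.

(** The difference is jointly continuous in [((x, y), n)] and vanishes at [n = e]; compactness of
    [G * G] makes the neighbourhood uniform. With [n] in the middle, left and right uniform
    continuity are both covered, as two-sided translations require. *)
Lemma cg_uniform_continuity (R : realType) (f : G -> R) (eps : R) :
  continuous f -> 0 < eps ->
  exists2 N, nbhs e N & forall x y n, N n ->
    `|f (mul x (mul n y)) - f (mul x y)| <= eps.
Proof.
move=> cf e0.
have cGG : compact [set: G * G].
  by rewrite -setXTT; apply: compact_setX; exact: (cg_compact hG).
have : \forall n \near nbhs e, [set: G * G] `<=`
    (fun p => `|f (mul p.1 (mul n p.2)) - f (mul p.1 p.2)| <= eps).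
  move/compact_near_coveringP : cGG; apply => -[x y] _.
  pose F (q : (G * G) * G) :=
    f (mul q.1.1 (mul q.2 q.1.2)) - f (mul q.1.1 q.1.2).
  have cF : continuous F.
    have c11 : continuous (fun q : (G * G) * G => q.1.1).
      by move=> q; apply: continuous_comp; [exact: continuous_fst|exact: continuous_fst].
    have c12 : continuous (fun q : (G * G) * G => q.1.2).
      by move=> q; apply: continuous_comp; [exact: continuous_fst|exact: continuous_snd].
    have c2 : continuous (fun q : (G * G) * G => q.2) by exact: continuous_snd.
    move=> q; apply: continuousB.
      by apply: (@continuous_comp _ _ _ _ f); [do !apply: cg_continuous_mul|exact: cf].
    by apply: (@continuous_comp _ _ _ _ f); [do !apply: cg_continuous_mul|exact: cf].
  have F0 : F ((x, y), e) = 0 by rewrite /F/= mul1 subrr.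
  have := cF ((x, y), e); rewrite /continuous_at F0.
  move=> /cvgr0_norm_le /(_ eps e0).
  by move=> [[U V] /= [nU nV] UV]; exists (U, V) => //= -[x' n] /= [? ?]; apply: (UV (x', n)).
move=> nN; exists [set n | [set: G * G] `<=`
    (fun p => `|f (mul p.1 (mul n p.2)) - f (mul p.1 p.2)| <= eps)] => //.
by move=> x y n /(_ (x, y)); exact.
Qed.

End compact_group.

(** A finitely supported measure is a list of pairs (weight, point), and [avg] is integration
    against it. The weights are constrained only in [prob_on], so linearity holds for every list. *)
Definition avg {R : realType} {G : Type} (p : seq (R * G)) (F : G -> R) : R :=
  \sum_(q <- p) q.1 * F q.2.

Definition prob_on {R : realType} {G : ptopologicalType} (W : set G)
    (p : seq (R * G)) :=
  (forall q, q \in p -> 0 <= q.1 /\ W q.2) /\ \sum_(q <- p) q.1 = 1.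

(** The bound is uniform in [F]: one [p] serves all functions with the same oscillation along [N],
    in particular all translates of a given function. *)
Definition almost_invariant {R : realType} {G : ptopologicalType}
    (mul : G -> G -> G) (W N : set G) (p : seq (R * G)) :=
  forall (F : G -> R) (eps : R),
    (forall x n, N n -> `|F (mul x n) - F x| <= eps) ->
    forall w, W w -> `|avg p (F \o mul w) - avg p F| <= eps.

Section almost_invariant.
Context {R : realType} {G : ptopologicalType}.
Context (mul : G -> G -> G) (inv : G -> G) (e : G).
Hypothesis hG : is_compact_group mul inv e.
Variable nu : {measure set (borel G) -> \bar R}.
Hypothesis hnu : haar_prob mul nu.

Let r (B : set (borel G)) : R := fine (nu B).

Lemma haar_prob_fin B : measurable B -> nu B \is a fin_num.
Proof.
move=> mB; rewrite ge0_fin_numE//; case: hnu => -[fnu _ _] _ _.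
by apply: le_lt_trans fnu; apply: le_measure => //; rewrite inE.
Qed.

(** If [V] were null, its left translates would be null open sets covering the compact group,
    against total mass 1. *)
Lemma haar_prob_open_gt0 (V : set G) : open V -> V !=set0 -> (0 < nu V)%E.
Proof.
move=> oV [v Vv]; rewrite lt0e measure_ge0 andbT; apply/eqP => nuV0.
have oVg g : open (mul g @` V) by exact: (cg_open_image_mull hG).
have nuVg g : nu (mul g @` V) = 0%E.
  by case: hnu => _ _ ->//; exact: measurable_borel_open.
have : nu [set: G] = 0%E.
  apply: measure_compact_eq0 => [||x _]; [exact: cg_compact hG|exact: measurableT|].
  exists (mul (mul x (inv v)) @` V); split => //.
  by exists v => //; rewrite (cg_mulgVK hG).
by case: hnu => _ -> _ /eqP; rewrite onee_eq0.
Qed.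

Variable W : set G.
Hypotheses (cW : compact W) (We : W e).
Hypothesis WM : forall x y, W x -> W y -> W (mul x y).
Hypothesis WV : forall x, W x -> W (inv x).

Let r_left_invariant g (B : set (borel G)) : measurable B -> r (mul g @` B) = r B.
Proof. by move=> mB; rewrite /r; case: hnu => _ _ ->. Qed.

Let r_partition n (E : nat -> set (borel G)) (X : set (borel G)) :
  (forall k, measurable (E k)) -> trivIset setT E -> measurable X ->
  X `<=` \big[setU/set0]_(k < n) E k -> r X = \sum_(k < n) r (X `&` E k).
Proof.
move=> mE tE mX XE.
have mXE k : measurable (X `&` E k) by exact: measurableI.
have -> : r X = r (\big[setU/set0]_(k < n) (X `&` E k)).
  rewrite -(bigcup_mkord n (fun k => X `&` E k)) -setI_bigcupr bigcup_mkord.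
  by rewrite (setIidl XE).
rewrite /r (@measure_semi_additive_ord_I _ _ _ nu (fun k => X `&` E k))//.
- by rewrite -sum_fine// => k _; exact: haar_prob_fin.
- by move=> i j _ _ [x [[_ Ei] [_ Ej]]]; apply: tE => //; exists x.
- by apply: bigsetU_measurable.
Qed.

(* The translates [w E k] and the [E k] are two partitions of the [W]-invariant
   set [D]; the weights [r (w E k & E l)] couple the two averages. *)
Lemma exists_almost_invariant (N : set G) : nbhs e N ->
  exists p : seq (R * G), prob_on W p /\ almost_invariant mul W N p.
Proof.
move=> Ne.
(* Two refinements: products of two elements of [V] lie in [M], so that the translates of [M] cover
   [D]; quotients of elements of [M] lie in [N], the final error. *)
have [M [oM Me MN]] := cg_nbhs_mul hG Ne.
have [V [oV Ve VM]] := cg_nbhs_mul hG (open_nbhs_nbhs (conj oM Me)).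
pose D : set (borel G) := \bigcup_(w in W) (mul w @` V).
have oD : open D by apply: bigcup_open => w _; exact: (cg_open_image_mull hG).
have mD : measurable D by exact: measurable_borel_open.
have D0 : 0 < r D.
  rewrite fine_gt0// haar_prob_open_gt0//=.
    by rewrite ltey_eq haar_prob_fin.
  by exists e, e => //; exists e => //; rewrite (cg_mul1g hG).
have := cW; rewrite compact_cover => /(_ _ W (fun w => mul w @` V)).
case=> [w _|w Ww|C CW WC]; first exact: (cg_open_image_mull hG).
  by exists w => //; exists e => //; rewrite (cg_mulg1 hG).
pose s : seq G := finmap.enum_fset C.
pose n := size s; pose w_ k := nth e s k.
(* Beyond the list, [nth] returns [e], which is also in [W]. *)
have Ww_ k : W (w_ k).
  have [kn|kn] := ltnP k n; last by rewrite /w_ nth_default.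
  by have := CW (w_ k); rewrite inE; apply; exact: mem_nth.
(* The cover of [D] by the sets [w_ k M], made disjoint. *)
pose E : nat -> set (borel G) := seqDU (fun k => D `&` (mul (w_ k) @` M)).
have mE k : measurable (E k).
  apply: measurableD; last apply: bigsetU_measurable => i _.
    by apply: measurableI => //; apply: measurable_borel_open; exact: (cg_open_image_mull hG).
  by apply: measurableI => //; apply: measurable_borel_open; exact: (cg_open_image_mull hG).
have tE : trivIset setT E by exact: trivIset_seqDU.
have DE : D = \big[setU/set0]_(k < n) E k.
  have -> : \big[setU/set0]_(k < n) E k = D `&` \bigcup_(k < n) (mul (w_ k) @` M).
    by rewrite setI_bigcupr bigcup_mkord /E -bigsetU_seqDU.
  apply/esym/setIidl => x [w Ww [v Vv <-]].
  have [c cC [v' Vv' <-]] := WC _ Ww.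
  exists (index c s) => /=; first by rewrite index_mem.
  exists (mul v' v); first by case: (VM _ _ Vv' Vv).
  by rewrite /w_ nth_index// (cg_assoc hG).
have ED k : E k `<=` D by move=> x [[]].
have EM k : E k `<=` mul (w_ k) @` M by move=> x [[]].
have wD w : W w -> mul w @` D = D.
  move=> Ww; apply/seteqP; split=> [_ [_ [u Wu [v Vv <-]] <-]|_ [u Wu [v Vv <-]]].
    by exists (mul w u); [exact: WM|exists v => //; rewrite (cg_assoc hG)].
  exists (mul (inv w) (mul u v)); last by rewrite (cg_mulVKg hG).
  exists (mul (inv w) u); first by apply: WM => //; exact: WV.
  by exists v => //; rewrite (cg_assoc hG).
have mwE w k : measurable (mul w @` E k : set (borel G)).
  rewrite (cg_image_mull hG).
  have := continuous_measurable_borel (cg_continuous_mull hG (g := inv w)).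
  by move=> /(_ measurableT _ (mE k)); rewrite setTI.
pose a k := r (E k) / r D.
exists [seq (a k, w_ k) | k : 'I_n <- index_enum 'I_n]; split; first split.
- move=> _ /mapP[k _ ->]; split => //=.
  by rewrite divr_ge0// fine_ge0.
- rewrite big_map/= -mulr_suml -[X in X / _ = _](_ : r D = _) ?divff ?gt_eqF//.
  rewrite (r_partition (n := n) mE tE mD) -?DE//.
  by apply: eq_bigr => k _; rewrite (setIidr (@ED k)).
move=> F eps FN w Ww.
pose Q k l := r ((mul w @` E k) `&` E l) / r D.
have mQ k l : measurable ((mul w @` E k) `&` E l : set (borel G)) by exact: measurableI.
have Q0 k l : 0 <= Q k l by rewrite divr_ge0// fine_ge0.
have Qk k : \sum_(l < n) Q k l = a k.
  rewrite -mulr_suml -(r_partition (n := n) mE tE (mwE w k)) ?r_left_invariant//.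
  by rewrite -DE -(wD _ Ww); apply: image_subset; exact: ED.
(* The second marginal is the first one for [inv w], after translating each intersection back by
   [w]. *)
have Ql l : \sum_(k < n) Q k l = a l.
  rewrite -mulr_suml; congr (_ / _).
  rewrite -[RHS](r_left_invariant (inv w))//.
  rewrite (r_partition (n := n) mE tE (mwE (inv w) l)); last first.
    by rewrite -DE -(wD _ (WV Ww)); apply: image_subset; exact: ED.
  apply: eq_bigr => k _; rewrite -[RHS](r_left_invariant w); last exact: measurableI.
  congr r; apply/seteqP; split=> [_ [[x Ex <-] Ewx]|_ [_ [[y Ey <-] Ek] <-]].
    by exists x => //; split => //; exists (mul w x) => //; rewrite (cg_mulKg hG).
  by rewrite (cg_mulVKg hG); split => //; eexists; [exact: Ek|rewrite (cg_mulVKg hG)].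
rewrite /avg !big_map/=.
have -> : \sum_(k < n) a k * F (mul w (w_ k)) =
    \sum_(k < n) \sum_(l < n) Q k l * F (mul w (w_ k)).
  by apply: eq_bigr => k _; rewrite -Qk mulr_suml.
have -> : \sum_(l < n) a l * F (w_ l) = \sum_(k < n) \sum_(l < n) Q k l * F (w_ l).
  by rewrite exchange_big/=; apply: eq_bigr => l _; rewrite -Ql mulr_suml.
rewrite -sumrB.
apply: (@le_trans _ _ (\sum_(k < n) \sum_(l < n) Q k l * eps)).
  apply: le_trans (ler_norm_sum _ _ _) _; apply: ler_sum => k _.
  rewrite -sumrB; apply: le_trans (ler_norm_sum _ _ _) _; apply: ler_sum => l _.
  rewrite -mulrBr normrM ger0_norm//.
  (* A positive weight needs some [x] in [E k] with [w x] in [E l]. Writing [x = w_ k m] and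
     [w x = w_ l m'] shows that [w w_ k] equals [w_ l] times an element of [N], so [F] differs by at
     most [eps]. *)
  have [EE|/set0P[_ [[x Ex <-] Ewx]]] := eqVneq ((mul w @` E k) `&` E l) set0.
    by rewrite /Q EE /r measure0 !mul0r.
  apply: ler_wpM2l => //.
  have [m Mm xE] := EM _ _ Ex; have [m' Mm' wxE] := EM _ _ Ewx.
  have -> : mul w (w_ k) = mul (w_ l) (mul m' (inv m)).
    by rewrite (cg_assoc hG) wxE -xE (cg_assoc hG) (cg_mulgK hG).
  by apply: FN; case: (MN _ _ Mm' Mm).
under eq_bigr do rewrite -mulr_suml Qk.
rewrite -mulr_suml -mulr_suml -[X in X / _](_ : r D = _) ?divff ?mul1r ?gt_eqF//.
rewrite (r_partition (n := n) mE tE mD) -?DE//.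
by apply: eq_bigr => k _; rewrite (setIidr (@ED k)).
Qed.

End almost_invariant.

(** * Integrals of continuous functions *)

Section integral_continuous.
Context {R : realType} {T : ptopologicalType}.
Hypothesis compT : compact [set: T].
Variable mu : {measure set (borel T) -> \bar R}.
Hypothesis mu_fin : (mu [set: T] < +oo)%E.

Lemma continuous_measurable_real (f : T -> R) : continuous f ->
  measurable_fun [set: borel T] (f : borel T -> R).
Proof.
move=> /continuousP cf; apply: (@measurability _ _ (borel T) _ setT f _ (RGenOpens.measurableE R)).
move=> _ [_ [a [b ->] <-]]; rewrite setTI; apply: measurable_borel_open.
exact/cf/interval_open.
Qed.

Lemma continuous_integrable (f : T -> R) : continuous f ->
  mu.-integrable [set: borel T] (EFin \o (f : borel T -> R)).
Proof.
move=> cf; apply: measurable_bounded_integrable => //.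
  exact: continuous_measurable_real.
have := @continuous_compact _ _ f [set: T] (continuous_subspaceT cf) compT.
move=> /compact_bounded[M [Mr MB]]; exists M; split => // x Mx y _.
by apply: (MB _ Mx); exists y.
Qed.

Lemma continuous_avg (X : topologicalType) (I : Type) (s : seq (R * I)) (F : I -> X -> R) :
  (forall i, continuous (F i)) -> continuous (fun x => avg s (F^~ x)).
Proof.
move=> cF; elim: s => [|q s IH].
  rewrite (_ : (fun x => _) = cst 0); first by move=> x; exact: cvg_cst.
  by apply/funext => x; rewrite /avg big_nil.
rewrite (_ : (fun x => _) = (fun x => q.1 * F q.2 x + avg s (F^~ x))).
  by move=> x; apply: cvgD; [apply: cvgM; [exact: cvg_cst|exact: cF]|exact: IH].
by apply/funext => x; rewrite /avg big_cons.
Qed.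

Lemma Rint_avg (I : Type) (s : seq (R * I)) (F : I -> T -> R) :
  (forall i, continuous (F i)) ->
  Defs.Rint mu (fun x => avg s (F^~ x)) = avg s (fun i => Defs.Rint mu (F i)).
Proof.
move=> cF; elim: s => [|q s IH].
  rewrite (_ : (fun x => _) = cst 0); last first.
    by apply/funext => x; rewrite /avg big_nil.
  by rewrite /avg big_nil /Defs.Rint Rintegral_cst// mul0r.
have -> : (fun x => avg (q :: s) (F^~ x)) = (fun x => q.1 * F q.2 x + avg s (F^~ x)).
  by apply/funext => x; rewrite /avg big_cons.
rewrite [RHS]/avg big_cons -[X in _ + X]/(avg s (fun i => Defs.Rint mu (F i))) -IH.
rewrite /Defs.Rint RintegralD//.
- by rewrite RintegralZl//; exact: continuous_integrable.
- apply: (continuous_integrable (f := fun x => q.1 * F q.2 x)) => x.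
  by apply: cvgM; [exact: cvg_cst|exact: cF].
- by apply: (continuous_integrable (f := fun x => avg s (F^~ x))); exact: continuous_avg.
Qed.

Lemma Rint_dist (f g : T -> R) (eps : R) : continuous f -> continuous g ->
  (forall x, `|f x - g x| <= eps) ->
  `|Defs.Rint mu f - Defs.Rint mu g| <= eps * fine (mu [set: T]).
Proof.
move=> cf cg fg; rewrite /Defs.Rint -RintegralB//; try exact: continuous_integrable.
have cB : continuous (fun x => f x - g x).
  by move=> x; apply: cvgB; [exact: cf|exact: cg].
apply: le_trans (le_normr_Rintegral _ _) _ => //; first exact: continuous_integrable.
rewrite -Rintegral_cst//; apply: le_Rintegral => //.
- apply: (continuous_integrable (f := fun x => `|f x - g x|)) => x.
  by apply: cvg_norm; exact: cB.
- by apply: (continuous_integrable (f := cst eps)) => x; exact: cst_continuous.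
Qed.

(** The sum is a staircase approximating [y] from below within [eps]. Truncating [y] by [Num.min]
    makes both bounds provable by induction on [n]; the truncation disappears once [y] is at most
    [n.+1%:R * eps]. *)
Lemma level_count_bounds (eps y : R) n : 0 <= eps -> 0 <= y ->
  (\sum_(j < n) eps * (j.+1%:R * eps < y)%R%:R <= Num.min y (n%:R * eps)) /\
  (Num.min y (n.+1%:R * eps) <= eps + \sum_(j < n) eps * (j.+1%:R * eps < y)%R%:R).
Proof.
move=> e0 y0; elim: n => [|n [IH1 IH2]].
  by rewrite big_ord0 mul0r addr0 mul1r le_min lexx y0 ge_min lexx orbT.
rewrite big_ord_recr/=; set S := \sum_(j < n) _ in IH1 IH2 *.
rewrite !le_min in IH1 *; case/andP: IH1 => Sy Sn.
have En (k : nat) : k.+1%:R * eps = k%:R * eps + eps by rewrite -natr1 mulrDl mul1r.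
have [ly|ly] := ltP (n.+1%:R * eps) y; rewrite ?mulr1 ?mulr0 ?addr0.
  split.
    rewrite En lerD2r Sn andbT.
    by apply: le_trans (ltW ly); rewrite En lerD2r.
  rewrite (min_idPr (ltW ly)) in IH2.
  by rewrite ge_min; apply/orP; right; rewrite (En n.+1) addrA lerD2r.
split; first by rewrite Sy/=; apply: le_trans Sn _; rewrite En lerDl.
by rewrite (min_idPl ly) in IH2; rewrite ge_min IH2.
Qed.

(** Integrate [level_count_bounds] pointwise. The levels start at [eps], not 0, so the staircase
    misses at most [eps] everywhere, which is the extra term in the upper bound. *)
Lemma layer_cake (f : T -> R) (eps : R) n : continuous f -> 0 <= eps ->
  (forall x, 0 <= f x <= n.+1%:R * eps) ->
  \sum_(j < n) eps * fine (mu [set x | j.+1%:R * eps < f x]) <= Defs.Rint mu f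
  <= eps * fine (mu [set: T]) +
     \sum_(j < n) eps * fine (mu [set x | j.+1%:R * eps < f x]).
Proof.
move=> cf e0 f0; set S := \sum_(j < n) _.
pose A (j : nat) : set (borel T) := [set x | j.+1%:R * eps < f x].
have mA j : measurable (A j).
  apply: measurable_borel_open.
  rewrite (_ : A j = f @^-1` [set y | j.+1%:R * eps < y])//.
  by move/continuousP : cf; apply; exact: open_gt.
pose g k x : R := \sum_(j < k) eps * \1_(A j) x.
have gE k x : g k x = \sum_(j < k) eps * (j.+1%:R * eps < f x)%R%:R.
  apply: eq_bigr => j _; rewrite indicE; congr (_ * _%:R).
  by congr nat_of_bool; apply/idP/idP; rewrite inE.
have i1 j : mu.-integrable setT (EFin \o (\1_(A j) : borel T -> R)).
  apply: measurable_bounded_integrable => //.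
  exists 1; split; first exact: num_real.
  move=> x x1 y _; rewrite /= indicE; apply: le_trans (ltW x1).
  by case: (_ \in _); rewrite ?normr1 ?normr0.
have ie j : mu.-integrable setT (EFin \o (fun x : borel T => eps * \1_(A j) x)).
  by have := integrableZl measurableT eps (i1 j).
have gP k : mu.-integrable setT (EFin \o (g k : borel T -> R)) /\
    Defs.Rint mu (g k) = \sum_(j < k) eps * fine (mu (A j)).
  elim: k => [|k [ik IH]].
    rewrite big_ord0 (_ : g 0%N = cst 0); last by apply/funext => x; rewrite /g big_ord0.
    split; last by rewrite /Defs.Rint Rintegral_cst// mul0r.
    exact: integrable0.
  rewrite big_ord_recr/= -IH.
  have -> : g k.+1 = (fun x => g k x + eps * \1_(A k) x).
    by apply/funext => x; rewrite /g big_ord_recr.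
  split; first by have := integrableD measurableT ik (ie k).
  rewrite /Defs.Rint RintegralD// RintegralZl//; congr (_ + _ * _).
  by rewrite /Rintegral integral_indic// setIT.
have [ig <-] : mu.-integrable setT (EFin \o (g n : borel T -> R)) /\ Defs.Rint mu (g n) = S.
  exact: gP.
have ic : mu.-integrable setT (EFin \o (cst eps : borel T -> R)).
  by apply: (continuous_integrable (f := cst eps)) => x; exact: cst_continuous.
have ifc := continuous_integrable cf.
rewrite -[X in _ + X]/(Rintegral mu setT (g n : borel T -> R)) -Rintegral_cst//.
rewrite -RintegralD//.
apply/andP; split; apply: le_Rintegral => //.
- move=> x _; rewrite -/(g n x) gE; have /andP[fx _] := f0 x.
  by have [] := level_count_bounds n e0 fx; rewrite le_min => /andP[].
- by have := integrableD measurableT ic ig.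
- move=> x _; rewrite -/(g n x) gE; have /andP[fx fn] := f0 x.
  by have [_] := level_count_bounds n e0 fx; rewrite (min_idPl fn).
Qed.

End integral_continuous.

(** * Left and right invariance of Haar integrals *)

Section haar_invariance.
Context {R : realType} {G : ptopologicalType}.
Context (mul : G -> G -> G) (inv : G -> G) (e : G).
Hypothesis hG : is_compact_group mul inv e.
Variable nu : {measure set (borel G) -> \bar R}.
Hypothesis hnu : haar_prob mul nu.

Let nu_fin : (nu [set: G] < +oo)%E.
Proof. by case: hnu => -[]. Qed.

Let nu1 : fine (nu [set: G]) = 1.
Proof. by case: hnu => _ ->. Qed.

Lemma Rint_haar_mull g (f : G -> R) : continuous f ->
  Defs.Rint nu (fun x => f (mul g x)) = Defs.Rint nu f.
Proof.
move=> cf; rewrite /Defs.Rint /Rintegral; congr fine.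
have mg := continuous_measurable_borel (cg_continuous_mull hG (g := g)).
have /measurable_EFinP mf := continuous_measurable_real cf.
have := integral_pushforward mg mf _ measurableT (mu := nu).
rewrite preimage_setT => <-.
  apply: eq_measure_integral => B mB _.
  have -> : nu B = nu (mul (inv g) @` B) by case: hnu => _ _ ->.
  by rewrite (cg_image_mull hG) (cg_invgK hG).
apply: (continuous_integrable (cg_compact hG) nu_fin (f := f \o mul g)).
by move=> x; apply: continuous_comp; [exact: (cg_continuous_mull hG)|exact: cf].
Qed.

(** Take [p] almost invariant under the whole group. The average of [f (w^-1 g)] over [w] is then
    within [eps / 2] of a constant [C], for all [g]. By left invariance, averaging does not change
    the integral of [f (x k)], so this integral is near [C] for every [k]; compare [k = h] with
    [k = e]. *)
Lemma Rint_haar_mulr h (f : G -> R) : continuous f ->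
  Defs.Rint nu (fun x => f (mul x h)) = Defs.Rint nu f.
Proof.
move=> cf; apply/eqP; rewrite -subr_eq0 -normr_le0; apply/ler_addgt0Pr => eps e0.
rewrite add0r.
have e2 : 0 < eps / 2 by rewrite divr_gt0.
have [N Ne Nf] := cg_uniform_continuity hG cf e2.
have [p [[p0 p1] pN]] := exists_almost_invariant hG hnu (cg_compact hG)
  (I : [set: G] e) (fun _ _ _ _ => I) (fun _ _ => I) Ne.
pose C := avg p (f \o inv).
have Cg g : `|avg p (fun w => f (mul (inv w) g)) - C| <= eps / 2.
  (* Left translation of [f \o inv] by [inv g] is [w |-> f (w^-1 g)]. *)
  have := pN (f \o inv) (eps / 2) _ (inv g) I.
  rewrite /comp/= (_ : (fun x => _) = (fun w => f (mul (inv w) g))); last first.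
    by apply/funext => x; rewrite (cg_invMg hG) (cg_invgK hG).
  apply => x n Nn; rewrite (cg_invMg hG) -normrN opprB.
  have := Nf e (mul (inv n) (inv x)) n Nn.
  by rewrite !(cg_mul1g hG) (cg_mulVKg hG).
have ctr w k : continuous (fun x => f (mul (inv w) (mul x k))).
  move=> x; apply: continuous_comp; last exact: cf.
  apply: (cg_continuous_mul hG); first exact: cst_continuous.
  exact: (cg_continuous_mulr hG).
have key k : `|Defs.Rint nu (fun x => f (mul x k)) - C| <= eps / 2.
  have -> : Defs.Rint nu (fun x => f (mul x k)) =
      Defs.Rint nu (fun x => avg p (fun w => f (mul (inv w) (mul x k)))).
    rewrite (Rint_avg (cg_compact hG) nu_fin p (fun w => @ctr w k)).
    rewrite /avg -[LHS]mul1r -p1 mulr_suml; apply: eq_bigr => q _; congr (_ * _).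
    rewrite -[LHS](Rint_haar_mull (inv q.2)); last first.
      move=> x; apply: continuous_comp; [exact: (cg_continuous_mulr hG)|exact: cf].
    by congr Defs.Rint; apply/funext => x; rewrite (cg_assoc hG).
  have -> : C = Defs.Rint nu (cst C) by rewrite /Defs.Rint Rintegral_cst// nu1 mulr1.
  rewrite -[leRHS]mulr1 -[X in _ * X]nu1; apply: Rint_dist => //.
  - exact: cg_compact hG.
  - by apply: continuous_avg => w; exact: ctr.
  - by move=> x; exact: cvg_cst.
have k1 := key h; have := key e.
rewrite (_ : (fun x => f (mul x e)) = f); last first.
  by apply/funext => x; rewrite (cg_mulg1 hG).
move=> k2; rewrite -(subrKA C); apply: le_trans (ler_normD _ _) _.
by rewrite [eps]splitr lerD// distrC.
Qed.

End haar_invariance.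

(** * Limits along an ultrafilter *)

(** Compactness of the segment gives a cluster point, and a cluster point of an ultrafilter is a
    limit. *)
Lemma cvg_ultra_bounded (R : realType) (I : Type) (U : set_system I)
    (FU : UltraFilter U) (x : I -> R) (a b : R) :
  (\forall i \near U, a <= x i <= b) -> exists l : R, x @ U --> l.
Proof.
move=> xab.
have := @segment_compact R a b (x @ U) _.
case=> [|l [_ xl]].
  by near=> i; rewrite /= in_itv/=; near: i.
exists l => V lV; have [//|nV] := in_ultra_setVsetC (x @^-1` V) FU.
by have [y []] := xl (~` V) V nV lV.
Unshelve. all: by end_near. Qed.

Lemma near_le_cvg (R : realType) (I : Type) (U : set_system I)
    {FU : ProperFilter U} (x y : I -> R) (a b : R) :
  x @ U --> a -> y @ U --> b -> (\forall i \near U, x i <= y i) -> a <= b.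
Proof.
move=> xa yb xy; rewrite -subr_ge0; apply: (cvgr_to_ge (cvgB yb xa)).
by near=> i; rewrite subr_ge0; near: i.
Unshelve. all: by end_near. Qed.

Lemma near_eq_cvg_unique (R : realType) (I : Type) (U : set_system I)
    {FU : ProperFilter U} (x y : I -> R) (a b : R) :
  x @ U --> a -> y @ U --> b -> (\forall i \near U, x i = y i) -> a = b.
Proof.
move=> xa yb xy; apply/eqP; rewrite eq_le; apply/andP; split.
  by apply: (near_le_cvg xa yb); near=> i; rewrite (near xy i).
by apply: (near_le_cvg yb xa); near=> i; rewrite (near xy i).
Unshelve. all: by end_near. Qed.

Lemma cvg_sum_ord (R : realType) (I : Type) (U : set_system I)
    {FU : ProperFilter U} n (x : nat -> I -> R) (a : nat -> R) :
  (forall j, x j @ U --> a j) ->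
  (fun i => \sum_(j < n) x j i) @ U --> \sum_(j < n) a j.
Proof.
move=> xa; elim: n => [|n IH].
  rewrite (_ : (fun i => _) = cst 0); last by apply/funext => i; rewrite big_ord0.
  by rewrite big_ord0; exact: cvg_cst.
rewrite big_ord_recr/= (_ : (fun i => _) = (fun i => \sum_(j < n) x j i + x n i)).
  exact: cvgD.
by apply/funext => i; rewrite big_ord_recr.
Qed.

Section ultralimit_measure.
Context {R : realType} {T : ptopologicalType}.
Hypotheses (hausT : hausdorff_space T) (compT : compact [set: T]).
Context {I : Type} (U : set_system I).
Hypothesis FU : UltraFilter U.
Variables (mp : I -> set T -> R) (L : I -> (T -> R) -> R) (t : R).
Hypothesis mp_ge0 : \forall p \near U,
  forall B : set (borel T), measurable B -> 0 <= mp p B.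
Hypothesis mpD : \forall p \near U, forall A B : set (borel T), measurable A ->
  measurable B -> A `&` B = set0 -> mp p (A `|` B) = mp p A + mp p B.
Hypothesis mpT : \forall p \near U, mp p [set: T] = t.
Hypothesis L_layer : \forall p \near U,
  forall (f : T -> R) (eps : R) n, continuous f -> 0 <= eps ->
  (forall x, 0 <= f x <= n.+1%:R * eps) ->
  \sum_(j < n) eps * mp p [set x | j.+1%:R * eps < f x] <= L p f.
Hypothesis LB : \forall p \near U, forall (f : T -> R) (c : R), continuous f ->
  L p (fun x => c - f x) = c * t - L p f.

Let cvg_mp (B : set (borel T)) : measurable B -> exists l : R, mp^~ B @ U --> l.
Proof.
move=> mB; apply: (@cvg_ultra_bounded _ _ _ _ _ 0 t); near=> p.
have p0 := near mp_ge0 p; have pD := near mpD p; have pT := near mpT p.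
apply/andP; split; first by apply: p0.
rewrite -pT// -(setUv B) pD//; last by rewrite setICr.
  by rewrite lerDl p0//; exact: measurableC.
exact: measurableC.
Unshelve. all: by end_near. Qed.

Let m (B : set T) : R := lim (mp^~ B @ U).

Let mE (B : set (borel T)) : measurable B -> mp^~ B @ U --> m B.
Proof. by move=> /cvg_mp[l /cvgP]. Qed.

(** The limit [m] of the set functions is finitely additive and yields [mu] by [radon_of_content].
    [L_layer] bounds integrals against [mu] by limits of [L], and [LB] reverses the inequality since
    the total masses agree. *)
Lemma ultralimit_measure : exists mu : {measure set (borel T) -> \bar R},
  [/\ radon mu, mu [set: T] = t%:E,
      forall V : set T, open V -> (\forall p \near U, mp p V = 0) -> mu V = 0%E &
      forall f : T -> R, continuous f -> L^~ f @ U --> Defs.Rint mu f].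
Proof.
have m_ge0 (A : set (borel T)) : measurable A -> 0 <= m A.
  by move=> mA; apply: (cvgr_to_ge (mE mA)); near=> p; apply: (near mp_ge0 p).
have mD (A B : set (borel T)) : measurable A -> measurable B ->
    A `&` B = set0 -> m (A `|` B) = m A + m B.
  move=> mA mB AB.
  have mAB : measurable (A `|` B : set (borel T)) by exact: measurableU.
  apply: (near_eq_cvg_unique (mE mAB) (cvgD (mE mA) (mE mB))).
  by near=> p; apply: (near mpD p).
have [mu [radmu muU muT]] := radon_of_content hausT compT m_ge0 mD.
have mT : m [set: T] = t.
  by apply: (near_eq_cvg_unique (mE measurableT) (cvg_cst t)); exact: mpT.
rewrite mT in muT.
have mufin : (mu [set: T] < +oo)%E by rewrite muT ltry.
exists mu; split => //.
  move=> V oV V0; apply/eqP; rewrite eq_le measure_ge0 andbT.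
  apply: le_trans (muU V oV) _; rewrite lee_fin.
  apply: (cvgr_to_le (mE (measurable_borel_open oV))).
  by apply: filterS V0 => p ->.
have t0 : 0 <= t by rewrite -lee_fin -muT measure_ge0.
have RB (f : T -> R) (M : R) : continuous f ->
    Defs.Rint mu (fun x => M - f x) = M * t - Defs.Rint mu f.
  move=> cf; rewrite /Defs.Rint RintegralB//.
  - by rewrite Rintegral_cst// muT.
  - by apply: (continuous_integrable compT mufin (f := cst M)) => x; exact: cvg_cst.
  - exact: continuous_integrable.
have cB (f : T -> R) (M : R) : continuous f -> continuous (fun x => M - f x).
  by move=> cf x; apply: cvgB; [exact: cvg_cst|exact: cf].
have H1 (f : T -> R) (M : R) : continuous f -> (forall x, 0 <= f x <= M) ->
    exists2 l : R, L^~ f @ U --> l & Defs.Rint mu f <= l.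
  move=> cf fM.
  have [l Ll] : exists l : R, L^~ f @ U --> l.
    apply: (@cvg_ultra_bounded _ _ _ _ _ 0 (M * t)); near=> p.
    have pL := near L_layer p; have pB := near LB p.
    have pos (g : T -> R) : continuous g -> (forall x, 0 <= g x <= M) -> 0 <= L p g.
      (* With [n = 0] and [eps = M] the layer sum is empty, so [L_layer] says that [L p] is
         positive. *)
      move=> cg gM; have := pL _ g M 0%N cg; rewrite big_ord0; apply => //.
        by have /andP[g0 gl] := gM point; apply: le_trans gl.
      by move=> x; rewrite mul1r.
    rewrite pos//= -subr_ge0 -pB// pos//; first exact: cB.
    by move=> x; have /andP[? ?] := fM x; rewrite subr_ge0 gerBl; apply/andP.
  exists l => //.
  (* Upper layer cake bound for [mu], then [mu <= m] on the open level sets, then the lower bound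
     [L_layer] in the limit. *)
  have key eps : 0 < eps -> Defs.Rint mu f <= eps * t + l.
    move=> e0; pose n := Num.bound (M / eps).
    have fn x : 0 <= f x <= n.+1%:R * eps.
      have /andP[-> fxM] := fM x; apply: le_trans fxM _.
      rewrite -ler_pdivrMr//.
      have M0 : 0 <= M by have /andP[] := fM point; exact: le_trans.
      have := archi_boundP (divr_ge0 M0 (ltW e0)); rewrite -/n => /ltW /le_trans; apply.
      by rewrite ler_nat.
    have /andP[_] := layer_cake compT mufin cf (ltW e0) fn.
    rewrite muT/= => /le_trans; apply; rewrite lerD2l.
    have oA (j : nat) : open [set x | j.+1%:R * eps < f x].
      rewrite (_ : [set x | _] = f @^-1` [set y | j.+1%:R * eps < y])//.
      by move/continuousP : cf; apply; exact: open_gt.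
    apply: (@le_trans _ _ (\sum_(j < n) eps * m [set x | j.+1%:R * eps < f x])).
      apply: ler_sum => j _; apply: ler_wpM2l; first exact: ltW.
      rewrite -lee_fin fineK; first exact: muU.
      rewrite ge0_fin_numE//; apply: le_lt_trans mufin.
      by apply: le_measure; rewrite ?inE//; exact: measurable_borel_open.
    have mS : (fun p => \sum_(j < n) eps * mp p [set x | j.+1%:R * eps < f x]) @ U -->
        \sum_(j < n) eps * m [set x | j.+1%:R * eps < f x].
      apply: (@cvg_sum_ord R I U _ n
        (fun j p => eps * mp p [set x | j.+1%:R * eps < f x])
        (fun j => eps * m [set x | j.+1%:R * eps < f x])) => j.
      apply: cvgM; first exact: cvg_cst.
      by apply: mE; exact: measurable_borel_open.
    apply: (near_le_cvg mS Ll).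
    by near=> p; apply: (near L_layer p) => //; exact: ltW.
  apply/ler_addgt0Pr => d d0.
  (* The mass [t] may be 0, hence the denominator [t + 1]. *)
  have dt : 0 < d / (t + 1) by rewrite divr_gt0// ltr_wpDl.
  apply: le_trans (key _ dt) _; rewrite addrC lerD2l -mulrA.
  by rewrite ler_piMr ?(ltW d0)// mulrC ler_pdivrMr ?ltr_wpDl// mul1r lerDl.
have H2 (f : T -> R) (M : R) : continuous f -> (forall x, 0 <= f x <= M) ->
    L^~ f @ U --> Defs.Rint mu f.
  move=> cf fM; have [l Ll le1] := H1 f M cf fM.
  have [|l' Ll' le2] := H1 (fun x => M - f x) M (cB _ _ cf).
    by move=> x; have /andP[? ?] := fM x; rewrite subr_ge0 gerBl; apply/andP.
  suff <- : l = Defs.Rint mu f by [].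
  apply/eqP; rewrite eq_le le1 andbT.
  have l'E : l' = M * t - l.
    apply: (near_eq_cvg_unique Ll' (cvgB (cvg_cst _) Ll)).
    by near=> p; apply: (near LB p).
  by move: le2; rewrite RB// l'E lerD2l lerN2.
move=> f cf.
have [M fM] : exists M, forall x, `|f x| <= M.
  have := @continuous_compact _ _ f [set: T] (continuous_subspaceT cf) compT.
  move=> /compact_bounded[M [Mr MB]]; exists (M + 1) => x.
  by apply: (MB (M + 1)); [rewrite ltrDl|exists x].
(* A function of arbitrary sign is recovered from the nonnegative function [M - f] through [LB]. *)
have Mf x : 0 <= M - f x <= M *+ 2.
  have := fM x; rewrite ler_norml => /andP[fM1 fM2].
  by rewrite subr_ge0 fM2/= mulr2n lerD2l lerNl.
have := cvgB (cvg_cst (M * t)) (H2 _ _ (cB _ M cf) Mf).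
rewrite RB// subKr => H.
have {}H : (fun p => M * t - L p (fun x => M - f x)) @ U --> Defs.Rint mu f by exact: H.
have E : {near U, (fun p => M * t - L p (fun x => M - f x)) =1 L^~ f}.
  by near=> p; rewrite /= (near LB p)// subKr.
by apply: cvg_trans H; exact: near_eq_cvg E.
Unshelve. all: by end_near. Qed.

End ultralimit_measure.

(** * Two-sided averages *)

Section avg_theory.
Context {R : realType} {G : ptopologicalType}.
Implicit Types (W : set G) (p : seq (R * G)) (F : G -> R).

Lemma le_avg W p F F' : prob_on W p -> (forall w, W w -> F w <= F' w) ->
  avg p F <= avg p F'.
Proof.
move=> [pW _] FF'; rewrite /avg big_seq [leRHS]big_seq; apply: ler_sum => q qp.
by have [q0 Wq] := pW q qp; apply: ler_wpM2l => //; exact: FF'.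
Qed.

Lemma eq_avg W p F F' : prob_on W p -> (forall w, W w -> F w = F' w) ->
  avg p F = avg p F'.
Proof.
move=> pW FF'; apply/eqP; rewrite eq_le.
by apply/andP; split; apply: (le_avg pW) => w Ww; rewrite FF'.
Qed.

Lemma avg_cst W p c : prob_on W p -> avg p (fun=> c) = c.
Proof. by move=> [_ p1]; rewrite /avg -mulr_suml p1 mul1r. Qed.

Lemma avgB p F F' : avg p (fun w => F w - F' w) = avg p F - avg p F'.
Proof. by rewrite /avg -sumrB; apply: eq_bigr => q _; rewrite mulrBr. Qed.

Lemma avgD p F F' : avg p (fun w => F w + F' w) = avg p F + avg p F'.
Proof. by rewrite /avg -big_split; apply: eq_bigr => q _; rewrite mulrDr. Qed.

Lemma avgZ p c F : avg p (fun w => c * F w) = c * avg p F.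
Proof. by rewrite /avg mulr_sumr; apply: eq_bigr => q _; rewrite mulrCA. Qed.

Lemma avg_sum p n (F : 'I_n -> G -> R) :
  avg p (fun w => \sum_(j < n) F j w) = \sum_(j < n) avg p (F j).
Proof.
by rewrite /avg exchange_big; apply: eq_bigr => q _; rewrite mulr_sumr.
Qed.

Lemma avg_exchange p (F : G -> G -> R) :
  avg p (fun a => avg p (F a)) = avg p (fun b => avg p (F^~ b)).
Proof.
rewrite /avg; under eq_bigr do rewrite mulr_sumr.
rewrite exchange_big; apply: eq_bigr => q _; rewrite mulr_sumr.
by apply: eq_bigr => s _; rewrite mulrCA.
Qed.

Lemma avg_ge0 W p F : prob_on W p -> (forall w, W w -> 0 <= F w) -> 0 <= avg p F.
Proof. by move=> pW F0; rewrite -(avg_cst 0 pW); exact: le_avg F0. Qed.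

Lemma avg_dist W p F F' eps : prob_on W p ->
  (forall w, W w -> `|F w - F' w| <= eps) -> `|avg p F - avg p F'| <= eps.
Proof.
move=> pW FF'; rewrite -avgB ler_norml; apply/andP; split.
  rewrite -[leLHS](avg_cst _ pW); apply: (le_avg pW) => w /FF'.
  by rewrite ler_norml => /andP[].
rewrite -[leRHS](avg_cst _ pW); apply: (le_avg pW) => w /FF'.
by rewrite ler_norml => /andP[].
Qed.

Lemma complex_avg p (h : G -> R[i]) :
  (avg p (fun w => complex.Re (h w)) +i* avg p (fun w => complex.Im (h w)))%C =
  \sum_(q <- p) (q.1)%:C%C * h q.2.
Proof.
rewrite /avg; elim: p => [|q p IH]; first by rewrite !big_nil.
rewrite !big_cons -IH; case: (h q.2) => x y /=.
by apply/eqP; rewrite eq_complex /= !mul0r subr0 addr0 !eqxx.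
Qed.

End avg_theory.

(** * Positive definite functions under two-sided averaging *)

Section positive_definite.
Context {R : realType} {G : ptopologicalType}.
Context (mul : G -> G -> G) (inv : G -> G) (e : G).
Hypothesis hG : is_compact_group mul inv e.

Definition sym_avg (p : seq (R * G)) (f : G -> R) (g : G) : R :=
  avg p (fun a => avg p (fun b => f (mul a (mul g (inv b))))).

(** Defined by parts to match [cint]; [csym_avgE] gives the complex sum on which positive
    definiteness acts. *)
Definition csym_avg (p : seq (R * G)) (f : G -> R[i]) (g : G) : R[i] :=
  (sym_avg p (fun x => complex.Re (f x)) g +i*
   sym_avg p (fun x => complex.Im (f x)) g)%C.

Lemma continuous_translate a b (f : G -> R) : continuous f ->
  continuous (fun g => f (mul a (mul g b))).
Proof.
move=> cf x; apply: continuous_comp; last exact: cf.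
apply: (cg_continuous_mul hG); first exact: cst_continuous.
exact: (cg_continuous_mulr hG).
Qed.

Lemma continuous_sym_avg p f : continuous f -> continuous (sym_avg p f).
Proof.
move=> cf.
apply: (@continuous_avg _ _ G p (fun a g => avg p (fun b => f (mul a (mul g (inv b)))))).
move=> a; apply: (@continuous_avg _ _ G p (fun b g => f (mul a (mul g (inv b))))).
by move=> b; exact: continuous_translate.
Qed.

Lemma csym_avgE p f g : csym_avg p f g =
  \sum_(q <- p) \sum_(s <- p)
    (q.1)%:C%C * ((s.1)%:C%C * f (mul q.2 (mul g (inv s.2)))).
Proof.
rewrite /csym_avg /sym_avg.
rewrite (complex_avg p (fun a =>
  (avg p (fun b => complex.Re (f (mul a (mul g (inv b))))) +i*
   avg p (fun b => complex.Im (f (mul a (mul g (inv b))))))%C)).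
apply: eq_bigr => q _.
by rewrite (complex_avg p (fun b => f (mul q.2 (mul g (inv b))))) mulr_sumr.
Qed.

Lemma pos_def_finType (I : finType) f (g : I -> G) (c : I -> R[i]) :
  pos_def mul inv f ->
  0 <= \sum_(i : I) \sum_(j : I) (c i)^*%C * f (mul (inv (g i)) (g j)) * c j.
Proof.
move=> [_ /(_ #|I| (g \o enum_val) (c \o enum_val))].
rewrite (reindex (enum_val (A := I))); last exact: onW_bij (enum_val_bij I).
under [X in _ -> 0 <= X]eq_bigr => i _.
  rewrite (reindex (enum_val (A := I))); last exact: onW_bij (enum_val_bij I).
  over.
by [].
Qed.

(** Since [a g_i^-1 g_j b^-1 = (g_i a^-1)^-1 (g_j b^-1)], the form of the average is the form of [f]
    at the points [g_i t_k^-1], indexed by pairs, with coefficients [c_i] times the real weight of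
    [t_k]. *)
Lemma pos_def_csym_avg p f : pos_def mul inv f -> pos_def mul inv (csym_avg p f).
Proof.
move=> fpd; have [[cRe cIm] _] := fpd; split.
  by split; exact: continuous_sym_avg.
move=> n g c; pose m := size p; pose t := tnth (in_tuple p).
have := @pos_def_finType ('I_n * 'I_m)%type f
  (fun ik => mul (g ik.1) (inv (t ik.2).2)) (fun ik => c ik.1 * ((t ik.2).1)%:C%C) fpd.
congr (0 <= _).
pose X i k j l := (c i * ((t k).1)%:C%C)^*%C *
  f (mul (inv (mul (g i) (inv (t k).2))) (mul (g j) (inv (t l).2))) *
  (c j * ((t l).1)%:C%C).
transitivity (\sum_(i < n) \sum_(k < m) \sum_(j < n) \sum_(l < m) X i k j l).
  rewrite [RHS]pair_bigA; apply: eq_bigr => -[i k] _ /=.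
  by rewrite [RHS]pair_bigA.
apply: eq_bigr => i _; rewrite exchange_big; apply: eq_bigr => j _.
have -> x : csym_avg p f x = \sum_(k < m) \sum_(l < m)
    ((t k).1)%:C%C * (((t l).1)%:C%C * f (mul (t k).2 (mul x (inv (t l).2)))).
  by rewrite csym_avgE big_tnth; apply: eq_bigr => k _; rewrite big_tnth.
rewrite mulr_sumr mulr_suml; apply: eq_bigr => k _.
rewrite mulr_sumr mulr_suml; apply: eq_bigr => l _.
rewrite /X (cg_invMg hG) (cg_invgK hG) -!(cg_assoc hG).
have -> : (c i * ((t k).1)%:C%C)^*%C = (c i)^*%C * ((t k).1)%:C%C.
  by case: (c i) => x y; apply/eqP; rewrite eq_complex/= !mulr0 !subr0 !add0r mulNr !eqxx.
set F := f _; ring.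
Qed.

(** The difference is the average of [f e - f (a b^-1)]. Adding the term with [a] and [b] exchanged
    gives the form of [f] at [a^-1, b^-1] with coefficients [1, -1]; hence the sum [S] is
    doubled. *)
Lemma csym_avg1_le p f W : prob_on W p -> pos_def mul inv f ->
  0 <= f e - csym_avg p f e.
Proof.
move=> [p0 p1] [_ fpd].
have f2 x y : 0 <= (f e - f (mul x (inv y))) + (f e - f (mul y (inv x))).
  have := fpd 2 (fun i => if i == 0 then inv x else inv y) (fun i => if i == 0 then 1 else -1).
  rewrite !big_ord_recl !big_ord0/= !(cg_invgK hG) !(cg_mulgV hG).
  rewrite !oppr0.
  have -> : (1 +i* 0)%C = 1 :> R[i] by [].
  have -> : (-1 +i* 0)%C = -1 :> R[i] by rewrite -[-1 in RHS]/((-1 -i* 0)%C) oppr0.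
  by congr (0 <= _); ring.
have p1C : \sum_(q <- p) (q.1)%:C%C = 1 :> R[i] by rewrite -rmorph_sum p1.
have -> : f e - csym_avg p f e =
    \sum_(q <- p) \sum_(s <- p) (q.1)%:C%C * ((s.1)%:C%C * (f e - f (mul q.2 (inv s.2)))).
  rewrite csym_avgE.
  have fe : f e = \sum_(q <- p) \sum_(s <- p) (q.1)%:C%C * ((s.1)%:C%C * f e).
    under eq_bigr do rewrite -mulr_sumr -mulr_suml p1C mul1r.
    by rewrite -mulr_suml p1C mul1r.
  rewrite {1}fe -sumrB; apply: eq_bigr => q _; rewrite -sumrB; apply: eq_bigr => s _.
  by rewrite (cg_mul1g hG) -!mulrBr.
set S := \sum_(q <- p) _.
suff : 0 <= S + S by rewrite -mulr2n pmulrn_lge0.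
rewrite {2}/S exchange_big -big_split/= big_seq sumr_ge0// => q qp.
rewrite -big_split/= big_seq sumr_ge0// => s sp.
rewrite (mulrCA (s.1)%:C%C) -!mulrDr.
have [q0 _] := p0 q qp; have [s0 _] := p0 s sp.
by rewrite !mulr_ge0// ler0c.
Qed.

End positive_definite.

(** Off the support every point has a null open neighbourhood, so compact subsets of [V] are null;
    inner regularity passes this to [V]. *)
Lemma radon_msupp_eq0 (R : realType) (T : ptopologicalType)
    (mu : {measure set (borel T) -> \bar R}) (V : set T) :
  hausdorff_space T -> radon mu -> open V -> V `&` msupp mu = set0 -> mu V = 0%E.
Proof.
move=> hT [_ _ inner] oV V0; apply/eqP; rewrite eq_le measure_ge0 andbT inner//.
apply: ge_ereal_sup => _ [K [cK KV] <-].
rewrite (measure_compact_eq0 cK)//.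
  by apply: measurable_borel_closed; exact: compact_closed.
move=> x Kx; apply: contrapT => nU.
suff : (V `&` msupp mu) x by rewrite V0.
split; first exact: KV.
move=> U oU Ux; rewrite lt0e measure_ge0 andbT; apply/eqP => U0.
by apply: nU; exists U.
Qed.

(** * The symmetrized measure and its invariance *)

Section symmetrization.
Context {R : realType} {G : ptopologicalType}.
Context (mul : G -> G -> G) (inv : G -> G) (e : G).
Hypothesis hG : is_compact_group mul inv e.

Let hausG := cg_hausdorff hG.
Let compG := cg_compact hG.

Lemma sym_avg_haar (nu : {measure set (borel G) -> \bar R}) W p (f : G -> R) :
  haar_prob mul nu -> prob_on W p -> continuous f ->
  Defs.Rint nu (sym_avg mul inv p f) = Defs.Rint nu f.
Proof.
move=> hnu pW cf.
have nu_fin : (nu [set: G] < +oo)%E by case: hnu => -[].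
have c1 a b := continuous_translate hG (a := a) (b := inv b) cf.
have c2 a := @continuous_avg _ _ _ p (fun b g => f (mul a (mul g (inv b)))) (c1 a).
rewrite (Rint_avg compG nu_fin p c2).
rewrite -[RHS](avg_cst _ pW); apply: (eq_avg pW) => a _.
rewrite (Rint_avg compG nu_fin p (c1 a)).
rewrite -[RHS](avg_cst _ pW); apply: (eq_avg pW) => b _.
have ca : continuous (fun x => f (mul a x)).
  by move=> x; apply: continuous_comp; [exact: (cg_continuous_mull hG)|exact: cf].
by rewrite (Rint_haar_mulr hG hnu (inv b) ca) (Rint_haar_mull hG hnu a cf).
Qed.

Variable W : set G.
Hypothesis WM : forall x y, W x -> W y -> W (mul x y).
Hypothesis WV : forall x, W x -> W (inv x).

(** Both translations become left translation by [inv w] of an averaging variable: of [a] in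
    [w^-1 a x b^-1], and of [b] in [a x b^-1 w = a x (w^-1 b)^-1]. *)
Lemma sym_avg_invariant (N : set G) p (f : G -> R) eps w x :
  prob_on W p -> almost_invariant mul W N p ->
  (forall x y n, N n -> `|f (mul x (mul n y)) - f (mul x y)| <= eps) -> W w ->
  `|sym_avg mul inv p (fun g => f (mul (inv w) g)) x - sym_avg mul inv p f x| <= eps /\
  `|sym_avg mul inv p (fun g => f (mul g w)) x - sym_avg mul inv p f x| <= eps.
Proof.
move=> pW pN Nf Ww; rewrite /sym_avg; split.
  rewrite (avg_exchange p) [X in _ - X](avg_exchange p); apply: (avg_dist pW) => b Wb.
  pose F a := f (mul a (mul x (inv b))).
  rewrite (_ : avg p _ = avg p (F \o mul (inv w))); last first.
    by congr avg; apply/funext => a; rewrite /F/= !(cg_assoc hG).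
  apply: pN; last exact: WV.
  by move=> y n Nn; rewrite /F -(cg_assoc hG); exact: Nf.
apply: (avg_dist pW) => a Wa.
pose F b := f (mul a (mul x (inv b))).
rewrite (_ : avg p _ = avg p (F \o mul (inv w))); last first.
  congr avg; apply/funext => b.
  by rewrite /F/= (cg_invMg hG) (cg_invgK hG) !(cg_assoc hG).
apply: pN; last exact: WV.
move=> y n Nn; rewrite /F distrC (cg_invMg hG) !(cg_assoc hG).
have := Nf (mul a x) (mul (inv n) (inv y)) n Nn.
by rewrite (cg_mulVKg hG) (cg_assoc hG).
Qed.

Variable mu : {measure set (borel G) -> \bar R}.
Hypothesis mu_fin : (mu [set: G] < +oo)%E.

Let t : R := fine (mu [set: G]).
Let translate (a b : G) (g : G) := mul a (mul g (inv b)).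
Let mp (p : seq (R * G)) (B : set G) : R :=
  avg p (fun a => avg p (fun b => fine (mu (translate a b @^-1` B)))).

Let mtranslate a b (B : set (borel G)) : measurable B ->
  measurable (translate a b @^-1` B : set (borel G)).
Proof.
move=> mB.
have c : continuous (translate a b).
  apply: (cg_continuous_mul hG); first exact: cst_continuous.
  exact: (cg_continuous_mulr hG).
by have := continuous_measurable_borel c measurableT mB; rewrite setTI.
Qed.

Let fin B : measurable B -> mu B \is a fin_num.
Proof.
move=> mB; rewrite ge0_fin_numE//; apply: le_lt_trans mu_fin.
by apply: le_measure; rewrite ?inE.
Qed.

Lemma Rint_sym_avg p (f : G -> R) : continuous f ->
  Defs.Rint mu (sym_avg mul inv p f) =
  avg p (fun a => avg p (fun b => Defs.Rint mu (fun g => f (translate a b g)))).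
Proof.
move=> cf; have c1 a b := continuous_translate hG (a := a) (b := inv b) cf.
have c2 a := @continuous_avg _ _ _ p (fun b g => f (mul a (mul g (inv b)))) (c1 a).
rewrite (Rint_avg compG mu_fin p c2).
by congr avg; apply/funext => a; rewrite (Rint_avg compG mu_fin p (c1 a)).
Qed.

(** [U] is returned along with [mu'], so that the positivity constraint can later be passed to the
    limit along it. *)
Lemma exists_symmetrization (nu : {measure set (borel G) -> \bar R}) :
  haar_prob mul nu -> compact W -> W e ->
  exists (U : set_system (seq (R * G))) (mu' : {measure set (borel G) -> \bar R}),
  [/\ ProperFilter U /\ radon mu',
      \forall p \near U, prob_on W p,
      forall V : set G, open V ->
        (forall a b, W a -> W b -> mu (translate a b @^-1` V) = 0%E) -> mu' V = 0%E,
      forall f : G -> R, continuous f ->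
        (fun p => Defs.Rint mu (sym_avg mul inv p f)) @ U --> Defs.Rint mu' f &
      forall w, W w -> forall f : G -> R, continuous f ->
        Defs.Rint mu' (fun g => f (mul (inv w) g)) = Defs.Rint mu' f /\
        Defs.Rint mu' (fun g => f (mul g w)) = Defs.Rint mu' f].
Proof.
move=> hnu cW We.
pose F0 := filter_from [set N : set G | nbhs e N]
  (fun N => [set p : seq (R * G) | prob_on W p /\ almost_invariant mul W N p]).
have FF0 : ProperFilter F0.
  apply: filter_from_proper; last first.
    by move=> N Ne; exact: (exists_almost_invariant hG hnu cW We WM WV).
  apply: filter_from_filter; first by exists setT; exact: filterT.
  move=> N1 N2 N1e N2e; exists (N1 `&` N2); first exact: filterI.
  (* Shrinking [N] admits more functions [F], so the condition on [p] becomes stronger and the sets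
     form a filter base. *)
  move=> p [pW pN]; split; split => // f eps Nf w Ww;
    by apply: pN => // x n [? ?]; exact: Nf.
have [U [FU F0U]] := ultraFilterLemma FF0.
have pW : \forall p \near U, prob_on W p.
  by apply: F0U; exists setT; [exact: filterT|move=> p []].
have PU : ProperFilter U by exact: ultra_proper.
exists U.
have [|||||mu' [rmu' muT mu0 muL]] :=
    @ultralimit_measure R G hausG compG _ U FU mp
      (fun p f => Defs.Rint mu (sym_avg mul inv p f)) t.
- near=> p; have pp := near pW p.
  by move=> B mB; do 2 apply: (avg_ge0 (pp _)) => // ? _; exact: fine_ge0.
- near=> p => A B mA mB AB; rewrite /mp -avgD; congr avg; apply/funext => a.
  rewrite -avgD; congr avg; apply/funext => b.
  rewrite preimage_setU measureU; [|exact: mtranslate|exact: mtranslate|].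
    by rewrite fineD//; apply: fin; exact: mtranslate.
  by rewrite -preimage_setI AB preimage_set0.
- near=> p; have pp := near pW p.
  rewrite -[RHS](avg_cst t (pp _))//; apply: (eq_avg (pp _)) => // a _.
  by rewrite -[RHS](avg_cst t (pp _))//; apply: (eq_avg (pp _)).
- near=> p => f eps n cf e0 fn; have pp := near pW p.
  rewrite Rint_sym_avg//.
  (* Level sets of a translate of [f] are preimages of level sets of [f]; the layer cake bound is
     applied to each translate and then averaged. *)
  apply: (@le_trans _ _ (avg p (fun a => avg p (fun b =>
      \sum_(j < n) eps * fine (mu [set x | j.+1%:R * eps < f (translate a b x)]))))).
    rewrite le_eqVlt; apply/orP; left; apply/eqP.
    transitivity (avg p (fun a => \sum_(j < n) avg p (fun b =>
        eps * fine (mu [set x | j.+1%:R * eps < f (translate a b x)])))).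
      rewrite avg_sum; apply: eq_bigr => j _.
      by rewrite /mp -avgZ; congr avg; apply/funext => a; rewrite -avgZ.
    by congr avg; apply/funext => a; rewrite -avg_sum.
  apply: (le_avg (pp _)) => // a _; apply: (le_avg (pp _)) => // b _.
  have := layer_cake compG mu_fin (continuous_translate hG (a := a) (b := inv b) cf) e0.
  by move=> /(_ n (fun x => fn _)) /andP[].
- near=> p => f c cf; have pp := near pW p.
  have cc : continuous (cst c : G -> R) by move=> x; exact: cvg_cst.
  have ccf : continuous (fun x => c - f x) by move=> x; apply: cvgB; [exact: cc|exact: cf].
  rewrite !Rint_sym_avg// -[c * t](avg_cst _ (pp _))// -avgB; congr avg.
  apply/funext => a; rewrite -[c * t](avg_cst _ (pp _))// -avgB; congr avg.
  apply/funext => b; rewrite /Defs.Rint RintegralB//.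
  - by rewrite Rintegral_cst.
  - exact: (continuous_integrable compG mu_fin cc).
  - exact: (continuous_integrable compG mu_fin (continuous_translate hG (a := a) (b := inv b) cf)).
exists mu'; split => //.
- move=> V oV V0; apply: mu0 => //; near=> p; have pp := near pW p.
  rewrite /mp -[RHS](avg_cst 0 (pp _))//; apply: (eq_avg (pp _)) => // a Wa.
  rewrite -[RHS](avg_cst 0 (pp _))//; apply: (eq_avg (pp _)) => // b Wb.
  by rewrite V0.
- move=> w Ww f cf.
  have inv_lim (g : G -> R) : continuous g ->
      (forall eps, 0 < eps -> \forall p \near U, forall x,
        `|sym_avg mul inv p g x - sym_avg mul inv p f x| <= eps) ->
      Defs.Rint mu' g = Defs.Rint mu' f.
    move=> cg gf; apply/eqP; rewrite -subr_eq0 -normr_le0; apply/ler_addgt0Pr => d d0.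
    have t1 : 0 < t + 1 by rewrite ltr_wpDl// fine_ge0.
    have dt : 0 < d / (t + 1) by rewrite divr_gt0.
    rewrite add0r; apply: (cvgr_to_le (cvg_norm (cvgB (muL _ cg) (muL _ cf)))).
    near=> p.
    apply: (@le_trans _ _ (d / (t + 1) * t)).
      apply: (Rint_dist compG mu_fin); try exact: (continuous_sym_avg hG).
      by move=> x; apply: (near (gf _ dt) p).
    by rewrite -mulrA ler_piMr ?(ltW d0)// mulrC ler_pdivrMr// mul1r lerDl.
  have close eps : 0 < eps -> \forall p \near U, forall x,
      `|sym_avg mul inv p (fun g => f (mul (inv w) g)) x - sym_avg mul inv p f x| <= eps /\
      `|sym_avg mul inv p (fun g => f (mul g w)) x - sym_avg mul inv p f x| <= eps.
    move=> e0; have [N Ne Nf] := cg_uniform_continuity hG cf e0.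
    apply: F0U; exists N => // p [pW' pN] x.
    exact: (sym_avg_invariant _ pW' pN Nf Ww).
  split; apply: inv_lim.
  - by move=> x; apply: continuous_comp; [exact: (cg_continuous_mull hG)|exact: cf].
  - by move=> eps /close; apply: filterS => p H x; case: (H x).
  - by move=> x; apply: continuous_comp; [exact: (cg_continuous_mulr hG)|exact: cf].
  - by move=> eps /close; apply: filterS => p H x; case: (H x).
Unshelve. all: by end_near. Qed.

End symmetrization.

(** For each [p], add [f e - f_p e >= 0] to the constraint on [mu] tested against [f_p]: the terms
    [f_p e] cancel and [nu f_p = nu f]. The complex inequality is a zero imaginary part and a
    nonnegative real part, both preserved by limits along [U]. *)
Lemma dual_psd_symmetrization (R : realType) (G : ptopologicalType)
    (mul : G -> G -> G) (inv : G -> G) (e : G) (hG : is_compact_group mul inv e)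
    (nu mu mu' : {measure set (borel G) -> \bar R}) (c : R) (W : set G)
    (U : set_system (seq (R * G))) (FU : ProperFilter U) :
  haar_prob mul nu -> (\forall p \near U, prob_on W p) ->
  (forall f : G -> R, continuous f ->
    (fun p => Defs.Rint mu (sym_avg mul inv p f)) @ U --> Defs.Rint mu' f) ->
  dual_psd mul inv e nu mu c -> dual_psd mul inv e nu mu' c.
Proof.
move=> hnu pW muL psd f fpd; have [[cRe cIm] _] := fpd.
have bound p : prob_on W p ->
    complex.Im (f e) + Defs.Rint mu (sym_avg mul inv p (fun x => complex.Im (f x)))
      - c * Defs.Rint nu (fun x => complex.Im (f x)) = 0 /\
    0 <= complex.Re (f e) + Defs.Rint mu (sym_avg mul inv p (fun x => complex.Re (f x)))
      - c * Defs.Rint nu (fun x => complex.Re (f x)).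
  move=> pp.
  have := addr_ge0 (csym_avg1_le hG pp fpd) (psd _ (pos_def_csym_avg hG p fpd)).
  have -> : cint nu (csym_avg mul inv p f) = cint nu f.
    by rewrite /cint /csym_avg/= !(sym_avg_haar hG hnu pp).
  rewrite addrA [X in X - _]addrA subrK lecE /cint/=.
  case: (f e) => x y /=; rewrite !mul0r subr0 addr0.
  by move=> /andP[/eqP ->].
have cvg_bound (g : G -> R) (x : R) : continuous g ->
    (fun p => x + Defs.Rint mu (sym_avg mul inv p g) - c * Defs.Rint nu g) @ U -->
    x + Defs.Rint mu' g - c * Defs.Rint nu g.
  move=> cg; apply: cvgB; last exact: cvg_cst.
  by apply: cvgD; [exact: cvg_cst|exact: muL].
have reP := cvg_bound _ (complex.Re (f e)) cRe.
have imP := cvg_bound _ (complex.Im (f e)) cIm.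
have im0 : complex.Im (f e) + Defs.Rint mu' (fun x => complex.Im (f x))
    - c * Defs.Rint nu (fun x => complex.Im (f x)) = 0.
  apply: (near_eq_cvg_unique imP (cvg_cst 0)).
  by apply: filterS pW => p /bound[].
have re0 : 0 <= complex.Re (f e) + Defs.Rint mu' (fun x => complex.Re (f x))
    - c * Defs.Rint nu (fun x => complex.Re (f x)).
  by apply: (cvgr_to_ge reP); apply: filterS pW => p /bound[].
rewrite lecE /cint/=; move: im0 re0; case: (f e) => x y /= im0 re0.
by rewrite !mul0r subr0 addr0 im0 eqxx.
Qed.

(** * Equality of the two suprema *)

Theorem theoremA2 (R : realType) (G : ptopologicalType)
    (mul : G -> G -> G) (inv : G -> G) (e : G)
    (hG : is_compact_group mul inv e)
    (nu : {measure set (borel G) -> \bar R}) (hnu : haar_prob mul nu)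
    (A : set G) (hAsym : forall x, A (inv x) <-> A x) (hAe : A e)
    (W : set G) (hWcl : closed W) (hWe : W e)
    (hWsub : forall x y, W x -> W y -> W (mul x (inv y)))
    (hWA : forall w, W w -> mul w @` A = A /\ (fun x => mul x w) @` A = A) :
  ereal_sup [set c%:E | c in
    [set c : R | exists mu : {measure set (borel G) -> \bar R},
        dual_feasible mul inv e A nu mu c]] =
  ereal_sup [set c%:E | c in
    [set c : R | exists mu : {measure set (borel G) -> \bar R},
        dual_feasible mul inv e A nu mu c /\ W_invariant mul inv W mu]].
Proof.
(* The two sets of attainable [c] already coincide. *)
congr ereal_sup; apply/seteqP; split=> _ [c [mu feas] <-]; exists c => //; last first.
  by exists mu; case: feas.
have {feas} [rmu smu psd] := feas.
have WV x : W x -> W (inv x).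
  by move=> Wx; rewrite -[inv x](cg_mul1g hG); exact: hWsub.
have WM x y : W x -> W y -> W (mul x y).
  by move=> Wx Wy; rewrite -[y](cg_invgK hG); apply: hWsub => //; exact: WV.
have mu_fin : (mu [set: G] < +oo)%E by case: rmu.
have cW : compact W by exact: (subclosed_compact hWcl (cg_compact hG)).
have [U [mu' [[PU rmu'] pW mu0 muL muW]]] :=
  exists_symmetrization hG WM WV mu_fin hnu cW hWe.
exists mu'; split; last first.
  move=> w Ww f [cRe cIm].
  have [r1 r2] := muW w Ww _ cRe; have [i1 i2] := muW w Ww _ cIm.
  by rewrite /cint; split; congr (_ +i* _)%C.
split => //; last exact: (dual_psd_symmetrization hG PU hnu pW muL psd).
pose V := ~` closure (~` A).
have oV : open V by apply: closed_openC; exact: closed_closure.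
have VA : V `<=` A.
  by move=> x nAx; apply: contrapT => /(@subset_closure _ (~` A)).
have muV : mu V = 0%E.
  apply: (radon_msupp_eq0 (cg_hausdorff hG) rmu oV).
  by apply/seteqP; split => // x [nx /smu].
move=> x mx; apply: contrapT => nx.
have := mx V oV nx; rewrite mu0 ?ltxx// => a b Wa Wb.
(* Here [B] is [a^-1 V b]. It lies in [A] because [a A = A = A b], and being open it misses the
   closure of the complement of [A]; so [B] is inside the null set [V]. *)
set B := _ @^-1` V.
have oB : open B.
  have c1 : continuous (fun g => mul a (mul g (inv b))).
    apply: (cg_continuous_mul hG); first exact: cst_continuous.
    exact: (cg_continuous_mulr hG).
  by move/continuousP : c1; apply.
have BA : B `<=` A.
  move=> g /VA /= Ag.
  have : (mul a @` A) (mul a (mul g (inv b))) by rewrite (hWA a Wa).1.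
  move=> [y Ay /(congr1 (mul (inv a)))]; rewrite !(cg_mulKg hG) => yE.
  have : ((fun x => mul x b) @` A) (mul y b) by exists y.
  by rewrite (hWA b Wb).2 yE (cg_mulgVK hG).
have BV : B `<=` V.
  move=> g Bg clg.
  have [y [nAy By]] := clg B (open_nbhs_nbhs (conj oB Bg)).
  exact: nAy (BA y By).
apply/eqP; rewrite eq_le measure_ge0 andbT -muV.
by apply: le_measure; rewrite ?inE//; exact: measurable_borel_open.
Qed.
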